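(* Let $n\ge3$ and let $g=\sum_{i=1}^n dx_i^2$ be the Euclidean metric on $\mathbb{R}^n$ with coordinates $x_1,\dots,x_n$. Fix $k\in\{1,\dots,n\}$, a constant $C>0$, and a smooth function $h=h(x_k)$ on $\mathbb{R}$ depending only on $x_k$. Consider the $(0,2)$-tensor $$T=f_k(x_k)\,dx_k^2+f(x_k)\sum_{i\neq k}dx_i^2,$$ where $$f_k(x_k)=\frac{h^2-2h_{,x_k}}{2C^2}\,e^{2\int h(x_k)\,dx_k},\qquad f(x_k)=-\frac{h^2}{2C^2}\,e^{2\int h(x_k)\,dx_k},$$ and let $R=T\odot g$. Then there exists a conformal metric $\bar g=g/\varphi^2$ on $\mathbb{R}^n$ whose Riemannian curvature tensor satisfies $\bar R=R$, with $$\varphi(x_k)=C\exp\left(-\int h(x_k)\,dx_k\right).$$ If, in addition, $0\le\left|\int h(x_k)\,dx_k\right|\le L$ for all $x_k\in\mathbb{R}$ for a finite constant $L$, then the metric $\bar g$ is complete on $\mathbb{R}^n$.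
   Context: $h_{,x_k}$ denotes the derivative of $h$; $\int h(x_k)\,dx_k$ denotes one fixed antiderivative of $h$ on $\mathbb{R}$, the same in all places. For symmetric $(0,2)$-tensors $p,q$ the Kulkarni–Nomizu product is $(p\odot q)(X,Y,Z,W)=p(X,Z)q(Y,W)+p(Y,W)q(X,Z)-p(X,W)q(Y,Z)-p(Y,Z)q(X,W)$. The Riemannian curvature $(0,4)$-tensor is taken with the sign convention for which a metric $\tilde g$ of constant sectional curvature $c$ has curvature tensor $\frac{c}{2}\,\tilde g\odot\tilde g$; equivalently $R_{\tilde g}=W_{\tilde g}+A_{\tilde g}\odot\tilde g$ with $W_{\tilde g}$ the Weyl tensor and $A_{\tilde g}=\frac{1}{n-2}\left(\mathrm{Ric}_{\tilde g}-\frac{K_{\tilde g}}{2(n-1)}\tilde g\right)$ the Schouten tensor, $K_{\tilde g}$ being the scalar curvature. *)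

(* Defs.v *)
From HB Require Import structures.
From mathcomp Require Export all_boot all_order all_algebra.
From mathcomp Require Export all_classical all_reals all_analysis.
Export Order.TTheory GRing.Theory Num.Theory.
Export numFieldNormedType.Exports.

Set Implicit Arguments.
Unset Strict Implicit.
Unset Printing Implicit Defensive.

Local Open Scope ring_scope.
Local Open Scope classical_set_scope.

(** R^n is ['rV[R]_n], with its global coordinates [x 0 i]; tangent vectors at
    every point are again elements of ['rV[R]_n]. *)

(** * Smooth functions *)

Definition smooth1 (R : realType) (h : R -> R) : Prop :=
  forall (m : nat) (t : R), derivable (h^`(m)) t 1.

Definition partial (R : realType) (n : nat) (i : 'I_n) (F : 'rV[R]_n -> R) :
  'rV[R]_n -> R := fun x => 'D_(delta_mx 0 i) F x.

(** C^oo on R^n: every iterated partial derivative is (Frechet) differentiable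
    everywhere, hence in particular exists and is continuous. *)
Definition smooth (R : realType) (n : nat) (F : 'rV[R]_n -> R) : Prop :=
  forall (s : seq 'I_n) (x : 'rV[R]_n),
    differentiable (foldr (@partial R n) F s) x.

(** * Tensor fields

    A (0,2)-tensor field is given by its component matrix in the coordinates
    x_1, ..., x_n. In particular dx_i^2 is [delta_mx i i]. *)

Definition tensor2 (R : realType) (n : nat) := 'rV[R]_n -> 'M[R]_n.

Definition tensor4 (R : realType) (n : nat) :=
  'rV[R]_n -> 'rV[R]_n -> 'rV[R]_n -> 'rV[R]_n -> 'rV[R]_n -> R.

Definition bilin (R : realType) (n : nat) (A : 'M[R]_n) (X Y : 'rV[R]_n) : R :=
  (X *m A *m Y^T) 0 0.

Definition kulkarni_nomizu (R : realType) (n : nat) (p q : tensor2 R n) :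
  tensor4 R n := fun x X Y Z W =>
    bilin (p x) X Z * bilin (q x) Y W + bilin (p x) Y W * bilin (q x) X Z
    - bilin (p x) X W * bilin (q x) Y Z - bilin (p x) Y Z * bilin (q x) X W.

(** * Riemannian metrics and curvature *)

Definition riemannian_metric (R : realType) (n : nat) (g : tensor2 R n) : Prop :=
  [/\ forall i j : 'I_n, smooth (fun x => g x i j),
      forall x, (g x)^T = g x
    & forall x (X : 'rV[R]_n), X != 0 -> 0 < bilin (g x) X X].

Definition euclidean (R : realType) (n : nat) : tensor2 R n :=
  fun _ => \sum_(i < n) delta_mx i i.

Definition conformal (R : realType) (n : nat) (g : tensor2 R n)
  (phi : 'rV[R]_n -> R) : tensor2 R n := fun x => (phi x ^+ 2)^-1 *: g x.

(** [christoffel g l i j] is the l-th component of nabla_(d_i) d_j for the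
    Levi-Civita connection of g. *)
Definition christoffel (R : realType) (n : nat) (g : tensor2 R n)
    (l i j : 'I_n) : 'rV[R]_n -> R := fun x =>
  2^-1 * \sum_(m < n) invmx (g x) l m *
    (partial i (fun y => g y j m) x + partial j (fun y => g y i m) x
     - partial m (fun y => g y i j) x).

(** [curvature_op g l i j k] is the l-th component of R(d_i, d_j) d_k, where
    R(X, Y) = [nabla_X, nabla_Y] - nabla_[X, Y]. *)
Definition curvature_op (R : realType) (n : nat) (g : tensor2 R n)
    (l i j k : 'I_n) : 'rV[R]_n -> R := fun x =>
  partial i (christoffel g l j k) x - partial j (christoffel g l i k) x
  + \sum_(m < n) (christoffel g l i m x * christoffel g m j k x
                  - christoffel g l j m x * christoffel g m i k x).

(** Rm(X, Y, Z, W) = g(R(X, Y)W, Z). With this order of arguments, constant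
    sectional curvature c means Rm = (c / 2) g (.) g for [kulkarni_nomizu]. *)
Definition curvature (R : realType) (n : nat) (g : tensor2 R n) : tensor4 R n :=
  fun x X Y Z W =>
    \sum_(i < n) \sum_(j < n) \sum_(k < n) \sum_(l < n)
      X 0 i * Y 0 j * Z 0 k * W 0 l *
      \sum_(m < n) g x k m * curvature_op g m i j l x.

(** * Completeness *)

(** C^1 on the closed interval [a, b]: c is continuous there and its derivative
    on the interior extends continuously to the end points. *)
Definition C1_on (R : realType) (n : nat) (a b : R) (c : R -> 'rV[R]_n) : Prop :=
  {within `[a, b], continuous c} /\
  exists2 d : R -> 'rV[R]_n, {within `[a, b], continuous d} &
    forall t, a < t < b -> is_derive t 1 c (d t).

Definition piecewise_C1 (R : realType) (n : nat) (c : R -> 'rV[R]_n) : Prop :=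
  exists2 s : seq R, itv_partition 0 1 s &
    forall i : nat, (i < size s)%N -> C1_on (nth 0 (0 :: s) i) (nth 0 s i) c.

(** The finitely many break points, where ['D_1 c] may be a default value, do
    not contribute to the integral. *)
Definition curve_length (R : realType) (n : nat) (g : tensor2 R n)
    (c : R -> 'rV[R]_n) : \bar R :=
  (\int[@lebesgue_measure R]_(t in `[0%R, 1%R])
     (Num.sqrt (bilin (g (c t)) ('D_1 c t) ('D_1 c t)))%:E)%E.

Definition riemannian_distance (R : realType) (n : nat) (g : tensor2 R n)
    (p q : 'rV[R]_n) : \bar R :=
  ereal_inf [set curve_length g c | c in
    [set c : R -> 'rV[R]_n | [/\ piecewise_C1 c, c 0 = p & c 1 = q]]].

(** (R^n, g) is complete as a metric space for the Riemannian distance. *)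
Definition complete_metric (R : realType) (n : nat) (g : tensor2 R n) : Prop :=
  forall u : nat -> 'rV[R]_n,
    (forall e : R, 0 < e -> exists N : nat, forall i j : nat,
       (N <= i)%N -> (N <= j)%N -> (riemannian_distance g (u i) (u j) < e%:E)%E) ->
    exists p : 'rV[R]_n, forall e : R, 0 < e -> exists N : nat, forall i : nat,
       (N <= i)%N -> (riemannian_distance g (u i) p < e%:E)%E.

(* Main.v *)
(** With E = exp(2H)/C^2 the metric g/phi^2 is E(x_k) times the Euclidean one, and
    E' = 2hE.  Its Christoffel symbols are h(x_k) times sums of products of
    Kronecker deltas, so the curvature identity is polynomial in the deltas, h
    and h'.  The equation E' = 2hE also makes E smooth, by induction on the order
    of differentiability.  If |H| <= L, then E lies between two positive
    constants, so the Riemannian distance is equivalent to the sup-norm distance,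
    by the fundamental theorem of calculus on each piece of a curve for the lower
    bound and by the length of the segment for the upper one; completeness is
    inherited from R^n. *)

Require Import Defs.
From mathcomp Require Import measurable_realfun ring.

Set Implicit Arguments.
Unset Strict Implicit.
Unset Printing Implicit Defensive.

Local Open Scope ring_scope.
Local Open Scope classical_set_scope.

(** * Differentiability of finite order in one variable *)

Definition derivable_upto (R : realType) (m : nat) (f : R -> R) : Prop :=
  forall j : nat, (j <= m)%N -> forall t : R, derivable (f^`(j)) t 1.

Section DerivableUpto.
Context {R : realType}.
Implicit Types f g : R -> R.

Lemma smooth1P f : smooth1 f <-> forall m, derivable_upto m f.
Proof.
split=> [sf m j _ t|sf m t]; first exact: sf.
exact: (sf m m (leqnn m)).
Qed.

(** Peels off the first derivative rather than the last, so that sums and products can be treated by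
    induction on the order with the functions generalised. *)
Lemma derivable_uptoS m f : derivable_upto m.+1 f <->
  (forall t, derivable f t 1) /\ derivable_upto m f^`().
Proof.
split=> [df|[df df'] [|j] jm t].
- split=> [t|j jm t]; first exact: (df 0 isT t).
  by rewrite -derive1Sn; apply: df.
- exact: df.
- by rewrite derive1Sn; apply: df'.
Qed.

Lemma derivable_uptoW m f : derivable_upto m.+1 f -> derivable_upto m f.
Proof. by move=> df j jm; apply: df; exact: leqW. Qed.

Lemma derivable_upto0 f : derivable_upto 0 f <-> forall t, derivable f t 1.
Proof. by split=> [df t|df [|//] _ t]; [exact: (df 0 isT t)|exact: df]. Qed.

Lemma derivable_upto_cst m (a : R) : derivable_upto m (cst a).
Proof.
elim: m a => [|m IH] a; first by apply/derivable_upto0.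
apply/derivable_uptoS; split=> //.
by rewrite (_ : _^`() = cst 0)//; apply/funext => t; rewrite derive1_cst.
Qed.

Lemma derivable_uptoD m f g : derivable_upto m f -> derivable_upto m g ->
  derivable_upto m (fun t => f t + g t).
Proof.
elim: m f g => [|m IH] f g.
  rewrite !derivable_upto0 => df dg t; exact: derivableD.
rewrite !derivable_uptoS => -[df df'] [dg dg']; split.
  by move=> t; exact: derivableD.
rewrite (_ : _^`() = fun t => derive1 f t + derive1 g t); first exact: IH.
by apply/funext => t; rewrite !derive1E deriveD.
Qed.

(** Induction through the Leibniz rule. The derivative of the product still contains [f] and [g]
    themselves, hence the weakening of their order to [m]. *)
Lemma derivable_uptoM m f g : derivable_upto m f -> derivable_upto m g ->
  derivable_upto m (fun t => f t * g t).
Proof.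
elim: m f g => [|m IH] f g.
  rewrite !derivable_upto0 => df dg t; exact: derivableM.
move=> /[dup] /derivable_uptoW Df /derivable_uptoS[df df'].
move=> /[dup] /derivable_uptoW Dg /derivable_uptoS[dg dg'].
apply/derivable_uptoS; split; first by move=> t; exact: derivableM.
rewrite (_ : _^`() = fun t => f t * derive1 g t + g t * derive1 f t).
  by apply: derivable_uptoD; exact: IH.
by apply/funext => t; rewrite !derive1E deriveM.
Qed.

Lemma smooth1_derive f : smooth1 f -> smooth1 f^`().
Proof. by move=> sf m t; rewrite -derive1Sn; exact: sf. Qed.

Lemma smooth1_cst (a : R) : smooth1 (cst a).
Proof. by apply/smooth1P => m; exact: derivable_upto_cst. Qed.

Lemma smooth1M f g : smooth1 f -> smooth1 g -> smooth1 (fun t => f t * g t).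
Proof. by rewrite !smooth1P => sf sg m; exact: derivable_uptoM. Qed.

(** Bootstrapping: if [f] has order [m], so does [f' = a f], and then [f] has order [m + 1].
    Counting orders is what makes this induction possible. *)
Lemma smooth1_linear_ode f (a : R -> R) : smooth1 a ->
  (forall t : R, is_derive t 1 f (a t * f t)) -> smooth1 f.
Proof.
move=> /smooth1P sa df; apply/smooth1P; elim=> [|m IH].
  by apply/derivable_upto0 => t; case: (df t).
apply/derivable_uptoS; split=> [t|]; first by case: (df t).
rewrite (_ : f^`() = fun t => a t * f t); first exact: derivable_uptoM.
by apply/funext => t; rewrite derive1E; case: (df t).
Qed.

End DerivableUpto.

(** * Functions on [R^n] depending on one coordinate *)

Section CoordinateFunctions.
Context {R : realType} {n : nat}.
Implicit Types (F G : R -> R) (k i : 'I_n) (x : 'rV[R]_n).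

Lemma diff_coord k x :
  'd (fun y : 'rV[R]_n => y 0 k) x = (fun y => y 0 k) :> (_ -> _).
Proof.
have @f : {linear 'rV[R]_n -> R}.
  by exists (fun N : 'rV[R]_n => N 0 k); do 2![eexists]; do ?[constructor];
     rewrite ?mxE// => ? *; rewrite ?mxE//; move=> ?; rewrite !mxE.
rewrite (_ : (fun y : 'rV[R]_n => y 0 k) = f)//.
by apply: diff_lin; exact: coord_continuous.
Qed.

Lemma differentiable_coord_comp F k x : derivable F (x 0 k) 1 ->
  differentiable (fun y : 'rV[R]_n => F (y 0 k)) x.
Proof.
move=> /derivable1_diffP dF.
apply: (@differentiable_comp _ _ _ _ (fun y : 'rV[R]_n => y 0 k) F) => //.
exact: differentiable_coord.
Qed.

(** Chain rule; the Kronecker delta is the [k]-th coordinate of the [i]-th basis vector. *)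
Lemma partial_coord_comp F k i x : derivable F (x 0 k) 1 ->
  partial i (fun y => F (y 0 k)) x = (i == k)%:R * derive1 F (x 0 k).
Proof.
move=> dF; rewrite /partial deriveE; last exact: differentiable_coord_comp.
have dc : differentiable (fun y : 'rV[R]_n => y 0 k) x.
  exact: differentiable_coord.
have := @diff_comp _ _ _ _ (fun y : 'rV[R]_n => y 0 k) F x dc.
move=> /(_ ((derivable1_diffP _ _).1 dF)); rewrite /comp => ->.
by rewrite deriv1E// diff_coord mxE eqxx/= eq_sym.
Qed.

Lemma smooth_coord_comp F k : smooth1 F -> smooth (fun x : 'rV[R]_n => F (x 0 k)).
Proof.
move=> sF s x.
(* Iterated partials stay of the form [G(x_k)] with [G] smooth; this stronger claim is the one that
   passes through the induction. *)
suff [G sG ->] : exists2 G, smooth1 G &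
    foldr (@partial R n) (fun x => F (x 0 k)) s = fun x => G (x 0 k).
  by apply: differentiable_coord_comp; exact: (sG 0).
elim: s => [|i s [G sG /= ->]]; first by exists F.
exists (fun t => (i == k)%:R * derive1 G t).
  by apply: smooth1M (smooth1_derive _); [exact: smooth1_cst|].
by apply/funext => y; apply: partial_coord_comp; exact: (sG 0).
Qed.

End CoordinateFunctions.

(** * Tensors in components *)

Section TensorAlgebra.
Context {R : realType} {n : nat}.

Lemma euclideanE x : @euclidean R n x = 1%:M.
Proof.
apply/matrixP => i j; rewrite summxE mxE (bigD1 i)//= !mxE eqxx/=.
rewrite big1 ?addr0 1?eq_sym// => a /negPf ai.
by rewrite !mxE [i == a]eq_sym ai.
Qed.

Lemma sum_delta (a : 'I_n) (F : 'I_n -> R) : \sum_m (a == m)%:R * F m = F a.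
Proof.
rewrite (bigD1 a)//= eqxx mul1r big1 ?addr0// => m /negPf ma.
by rewrite eq_sym ma mul0r.
Qed.

Lemma bilinE (A : 'M[R]_n) X Y :
  bilin A X Y = \sum_i \sum_j X 0 i * A i j * Y 0 j.
Proof.
rewrite /bilin mxE exchange_big; apply: eq_bigr => j _.
by rewrite mxE mulr_suml; apply: eq_bigr => i _; rewrite !mxE.
Qed.

Lemma bilin_scalar (a : R) (X Y : 'rV[R]_n) :
  bilin a%:M X Y = a * \sum_i X 0 i * Y 0 i.
Proof.
rewrite bilinE mulr_sumr; apply: eq_bigr => i _.
rewrite -[RHS](sum_delta i (fun j => a * (X 0 i * Y 0 j))).
by apply: eq_bigr => j _; rewrite !mxE -mulr_natr; ring.
Qed.

(** Gives the product the quadruple-sum shape of [curvature], so that the two tensors can be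
    compared component by component. *)
Lemma kulkarni_nomizuE (p q : tensor2 R n) x X Y Z W :
  kulkarni_nomizu p q x X Y Z W =
  \sum_i \sum_j \sum_k \sum_l X 0 i * Y 0 j * Z 0 k * W 0 l *
    (p x i k * q x j l + p x j l * q x i k
     - p x i l * q x j k - p x j k * q x i l).
Proof.
have XZYW (A B : 'M[R]_n) : bilin A X Z * bilin B Y W =
    \sum_i \sum_j \sum_k \sum_l X 0 i * Y 0 j * Z 0 k * W 0 l * (A i k * B j l).
  rewrite !bilinE mulr_suml; apply: eq_bigr => i _.
  rewrite mulr_sumr; apply: eq_bigr => j _.
  rewrite mulr_suml; apply: eq_bigr => k _.
  by rewrite mulr_sumr; apply: eq_bigr => l _; ring.
have XWYZ (A B : 'M[R]_n) : bilin A X W * bilin B Y Z =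
    \sum_i \sum_j \sum_k \sum_l X 0 i * Y 0 j * Z 0 k * W 0 l * (A i l * B j k).
  rewrite !bilinE mulr_suml; apply: eq_bigr => i _.
  rewrite mulr_sumr; apply: eq_bigr => j _.
  (* The first factor now carries the index of [W], so the two inner sums on the right are exchanged
     before distributing. *)
  rewrite exchange_big/= mulr_suml; apply: eq_bigr => k _.
  by rewrite mulr_sumr; apply: eq_bigr => l _; ring.
rewrite /kulkarni_nomizu XZYW [bilin (p x) Y W * _]mulrC XZYW XWYZ.
rewrite [bilin (p x) Y Z * _]mulrC XWYZ -big_split/= -!sumrB.
apply: eq_bigr => i _; rewrite -big_split/= -!sumrB.
apply: eq_bigr => j _; rewrite -big_split/= -!sumrB.
apply: eq_bigr => k _; rewrite -big_split/= -!sumrB.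
by apply: eq_bigr => l _; ring.
Qed.

End TensorAlgebra.

(** * Curvature of [E(x_k)] times the Euclidean metric *)

Section ConformallyFlat.
Context {R : realType} {n : nat} (k : 'I_n) (E h : R -> R).
Hypothesis E_gt0 : forall t, 0 < E t.
Hypothesis dE : forall t : R, is_derive t 1 E (2 * h t * E t).
Hypothesis dh : forall t : R, derivable h t 1.

Let g : tensor2 R n := fun x => (E (x 0 k))%:M.
Local Notation "''δ' i j" := ((i == j)%:R : R) (at level 10, i, j at level 9).

Lemma partial_metric (a i j : 'I_n) x :
  partial a (fun y => g y i j) x =
    'δ a k * 'δ i j * (2 * h (x 0 k) * E (x 0 k)).
Proof.
pose F := fun t => 'δ i j * E t.
have dF (t : R) : is_derive t 1 F ('δ i j * (2 * h t * E t)).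
  by have := @is_deriveZ R _ _ E ('δ i j) t 1 _ (dE t).
rewrite (_ : (fun y => g y i j) = fun y => F (y 0 k)); last first.
  by apply/funext => y; rewrite /g/F mxE mulr_natl.
rewrite partial_coord_comp; last by case: (dF (x 0 k)).
by rewrite derive1E (@derive_val _ _ _ _ _ _ _ (dF _)); ring.
Qed.

(** Writing [E = e^(2u)] with [u' = h], these are the symbols of a conformally flat metric: the
    factor [1/E] of the inverse metric cancels the [E] in [E' = 2hE]. *)
Lemma christoffel_conformally_flat (l i j : 'I_n) x :
  christoffel g l i j x =
    ('δ l i * 'δ j k + 'δ l j * 'δ i k - 'δ i j * 'δ l k) * h (x 0 k).
Proof.
rewrite /christoffel; have /lt0r_neq0 E0 := E_gt0 (x 0 k).
under eq_bigr => m _ do rewrite !partial_metric.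
(* The inverse metric is diagonal; its delta is pulled out so that [sum_delta] collapses the sum. *)
rewrite (eq_bigr (fun m => 'δ l m * ((E (x 0 k))^-1
    * ('δ i k * 'δ j m + 'δ j k * 'δ i m - 'δ m k * 'δ i j)
    * (2 * h (x 0 k) * E (x 0 k))))); last first.
  by move=> m _; rewrite invmx_scalar !mxE -[_ *+ (l == m)]mulr_natl; ring.
rewrite sum_delta.
rewrite [j == l]eq_sym [i == l]eq_sym; field.
exact: E0.
Qed.

(** The conformal change law over a flat metric: [|du|^2 = h^2] gives the first term, and
    [Hess u - du (x) du], whose only entry is [h' - h^2] at [k, k], gives the second. *)
Lemma curvature_op_conformally_flat (l i j p : 'I_n) x :
  curvature_op g l i j p x =
    ('δ l i * 'δ j p - 'δ l j * 'δ i p) * - h (x 0 k) ^+ 2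
    + ('δ i k * ('δ l j * 'δ p k + 'δ l p * 'δ j k - 'δ j p * 'δ l k)
       - 'δ j k * ('δ l i * 'δ p k + 'δ l p * 'δ i k - 'δ i p * 'δ l k))
      * (derive1 h (x 0 k) - h (x 0 k) ^+ 2).
Proof.
have pchr a b c d : partial a (christoffel g b c d) x =
    'δ a k * ('δ b c * 'δ d k + 'δ b d * 'δ c k - 'δ c d * 'δ b k)
      * derive1 h (x 0 k).
  set e := _ - _.
  rewrite (_ : christoffel g b c d = fun y => e * h (y 0 k)); last first.
    by apply/funext => y; rewrite christoffel_conformally_flat.
  rewrite (@partial_coord_comp _ _ (fun t => e * h t)); last exact: derivableZ.
  by rewrite derive1Ml// mulrA.
(* The deltas of the first factor alone carry out the contraction over [m]; the second factor stays
   unexpanded until the end. *)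
have chr2 a b c d : \sum_m christoffel g a b m x * christoffel g m c d x =
    h (x 0 k) * ('δ a b * christoffel g k c d x
      + 'δ b k * christoffel g a c d x - 'δ a k * christoffel g b c d x).
  rewrite -(sum_delta k (fun m => christoffel g m c d x)).
  rewrite -(sum_delta a (fun m => christoffel g m c d x)).
  rewrite -(sum_delta b (fun m => christoffel g m c d x)).
  rewrite !mulr_sumr -big_split -sumrB/= mulr_sumr.
  apply: eq_bigr => m _.
  rewrite [christoffel g a b m x]christoffel_conformally_flat.
  by rewrite [k == m]eq_sym; ring.
rewrite /curvature_op !pchr sumrB !chr2 !christoffel_conformally_flat.
(* Once each delta has a single orientation and [k == k] is replaced by 1, the identity is
   polynomial and no case analysis on indices is left. *)
rewrite !eqxx/= [k == i]eq_sym [k == j]eq_sym [k == p]eq_sym [j == i]eq_sym.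
by ring.
Qed.
(** The first factor is [-E (Hess u - du (x) du + |du|^2/2 g0)], with [g0] Euclidean. For [n >= 3]
    it is [E] times the Schouten tensor; the factor [E] appears because the product is taken with
    [g0] instead of [E g0]. *)
Lemma curvature_conformally_flat :
  curvature g = kulkarni_nomizu (fun x =>
    ((h (x 0 k) ^+ 2 / 2 - derive1 h (x 0 k)) * E (x 0 k)) *: delta_mx k k
    + (- (h (x 0 k) ^+ 2 / 2) * E (x 0 k)) *: \sum_(i < n | i != k) delta_mx i i)
    (@euclidean R n).
Proof.
have offdiag :
    \sum_(i < n | i != k) delta_mx i i = 1%:M - delta_mx k k :> 'M[R]_n.
  by rewrite -(euclideanE 0) /euclidean [in RHS](bigD1 k)//= addrC addrK.
apply/funext => x; apply/funext => X; apply/funext => Y; apply/funext => Z.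
apply/funext => W; rewrite kulkarni_nomizuE /curvature.
apply: eq_bigr => i _; apply: eq_bigr => j _; apply: eq_bigr => c _.
apply: eq_bigr => l _; congr (_ * _).
rewrite (eq_bigr (fun m => 'δ c m * (E (x 0 k) * curvature_op g m i j l x))).
  rewrite sum_delta curvature_op_conformally_flat offdiag euclideanE !mxE.
  (* An entry of [delta_mx] tests a conjunction; it is split into a product of two deltas. *)
  rewrite -!mulnb !natrM [c == i]eq_sym [c == j]eq_sym [c == l]eq_sym.
  by field.
by move=> m _; rewrite mxE mulrA mulr_natl.
Qed.

End ConformallyFlat.

(** * Integral estimates along a partition of an interval *)

Section IntegralOverPartition.
Context {R : realType}.
Implicit Types (f F d : R -> R) (a b : R) (s : seq R).

(** Only open pieces are assumed, since the velocity of a piecewise [C^1] curve is uncontrolled at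
    break points; adding finitely many points preserves measurability. *)
Lemma measurable_fun_partition f a b s : itv_partition a b s ->
  (forall i, (i < size s)%N ->
     measurable_fun `]nth 0 (a :: s) i, nth 0 s i[ f) ->
  measurable_fun `[a, b] f.
Proof.
elim: s a => [|x s IH] a pab mf.
  by rewrite (itv_partition_nil pab) set_itv1; exact: measurable_fun_set1.
have ax : a < x by case: pab => /= /andP[].
have xb : x <= b.
  by apply: itv_partition_le (itv_partition_cons pab).
rewrite (@itv_bndbnd_setU _ _ _ (BRight x)) ?bnd_simp ?(ltW ax)//.
apply/measurable_funU => //; split.
  apply/measurable_fun_itv_bndo_bndcP; apply/measurable_fun_itv_obnd_cbndP.
  exact: (mf 0%N).
apply/measurable_fun_itv_obnd_cbndP; apply: (IH _ (itv_partition_cons pab)) => i.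
exact: (mf i.+1).
Qed.

(** The triangle inequality along the break points, matched with additivity of the integral. *)
Lemma le_dist_integral_partition f F a b s : itv_partition a b s ->
  measurable_fun `[a, b] f -> (forall t, 0 <= f t) ->
  (forall i, (i < size s)%N ->
     measurable_fun `[nth 0 (a :: s) i, nth 0 s i] f ->
     (`|F (nth 0 s i) - F (nth 0 (a :: s) i)|%:E <=
      \int[@lebesgue_measure R]_(t in `[nth 0%R (a :: s) i, nth 0%R s i])
        (f t)%:E)%E) ->
  (`|F b - F a|%:E <= \int[@lebesgue_measure R]_(t in `[a, b]) (f t)%:E)%E.
Proof.
elim: s a => [|x s IH] a pab mf f0 le_f.
  rewrite (itv_partition_nil pab) subrr normr0.
  by apply: integral_ge0 => t _; rewrite lee_fin.
have ax : a < x by case: pab => /= /andP[].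
have xb : x <= b.
  by apply: itv_partition_le (itv_partition_cons pab).
have mxb : measurable_fun `[x, b] f.
  apply: measurable_funS mf => // t /=.
  by rewrite !in_itv/= => /andP[/(le_trans (ltW ax)) -> ->].
have Uab := @itv_bndbnd_setU _ _ (BLeft a) (BRight x) (BRight b).
rewrite Uab ?bnd_simp ?(ltW ax)// ge0_integral_setU//=; first last.
- apply/disj_setPS => t /=; rewrite !in_itv/= => -[/andP[_ tx] /andP[xt _]].
  by move: tx; rewrite leNgt xt.
- by move=> t _; rewrite lee_fin.
- by rewrite -Uab ?bnd_simp ?(ltW ax)//; exact/measurable_EFinP.
(* The common end point [x] is null, so the second piece may be closed again for the induction. *)
rewrite integral_itv_obnd_cbnd; last first.
  by apply/measurable_EFinP/measurable_fun_itv_obnd_cbndP.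
apply: (@le_trans _ _ (`|F x - F a|%:E + `|F b - F x|%:E)%E).
  by rewrite -EFinD lee_fin -(subrKA (F x)) addrC ler_normD.
apply: leeD.
  apply: (le_f 0%N) => //; apply: measurable_funS mf => // t /=.
  by rewrite !in_itv/= => /andP[-> /le_trans]; exact.
apply: (IH _ (itv_partition_cons pab)) => // i si.
exact: (le_f i.+1).
Qed.

(** By the fundamental theorem of calculus the increment is the integral of [d], whose absolute
    value is at most the integral of [|d|]. *)
Lemma le_dist_integral_derive f F d a b : a < b ->
  {within `[a, b], continuous F} -> {within `[a, b], continuous d} ->
  (forall t : R, a < t < b -> is_derive t 1 F (d t)) ->
  measurable_fun `[a, b] f -> (forall t, a < t < b -> `|d t| <= f t) ->
  (`|F b - F a|%:E <= \int[@lebesgue_measure R]_(t in `[a, b]) (f t)%:E)%E.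
Proof.
move=> ab cF cd dF mf df.
have md : measurable_fun `[a, b] d by exact: subspace_continuous_measurable_fun.
have oocc (g : R -> R) : measurable_fun `[a, b] g -> measurable_fun `]a, b[ g.
  by move=> mg; apply: measurable_funS mg => //; exact: subset_itv_oo_cc.
have [_ Fa Fb] := (continuous_within_itvP F ab).1 cF.
rewrite -abse_EFin EFinB -(continuous_FTC2 ab cd); first last.
- move=> t; rewrite in_itv/= => /dF dFt.
  by rewrite derive1E (@derive_val _ _ _ _ _ _ _ dFt).
- by split=> // t; rewrite in_itv/= => /dF[].
apply: le_trans (le_abse_integral _ _ _) _ => //; first exact/measurable_EFinP.
have mnd : measurable_fun `]a, b[ (EFin \o (fun t => `|d t|)).
  by apply/measurable_EFinP; exact: measurableT_comp (oocc _ md).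
have mfE : measurable_fun `]a, b[ (EFin \o f) .
  by apply/measurable_EFinP; exact: oocc.
(* The bound on [d] holds only in the interior, hence the passage to the open interval. *)
rewrite (@integral_itv_bndoo _ a b _ true false mnd).
rewrite (@integral_itv_bndoo _ a b _ true false mfE).
apply: ge0_le_integral => // t /=.
by rewrite in_itv/= => /df; rewrite lee_fin.
Qed.

End IntegralOverPartition.

(** * Comparison of the Riemannian distance with the sup norm *)

Section ConformallyFlatDistance.
Context {R : realType} {n : nat} (E : 'rV[R]_n -> R) (m M : R).
Hypothesis cE : continuous E.
Hypothesis m_gt0 : 0 < m.
Hypothesis M_gt0 : 0 < M.
Hypothesis mE : forall x, m ^+ 2 <= E x.
Hypothesis EM : forall x, E x <= M ^+ 2.

Let g : tensor2 R n := fun x => (E x)%:M.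
Implicit Types (c : R -> 'rV[R]_n) (p q v : 'rV[R]_n).

Let speed c (t : R) : R := Num.sqrt (bilin (g (c t)) ('D_1 c t) ('D_1 c t)).

Let speedE c t :
  speed c t = Num.sqrt (E (c t) * \sum_i 'D_1 c t 0 i * 'D_1 c t 0 i).
Proof. by rewrite /speed bilin_scalar. Qed.

Lemma norm_coord_le (v : 'rV[R]_n) i : `|v 0 i| <= `|v|.
Proof.
rewrite [leRHS]/Num.Def.normr/= mx_normrE.
exact: (le_bigmax _ (fun ij : 'I_1 * 'I_n => `|v ij.1 ij.2|) (0, i)).
Qed.

Lemma is_derive_coord c (t : R) v i :
  is_derive t 1 c v -> is_derive t 1 (fun s => c s 0 i) (v 0 i).
Proof.
move=> [dc dv]; split; first exact: (derivable_mxP _ _ _).1 dc _ _.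
by rewrite -dv derive_mx// mxE.
Qed.

Lemma within_continuous_coord c (A : set R) i :
  {within A, continuous c} -> {within A, continuous (fun s => c s 0 i)}.
Proof.
move=> cc.
apply: (@within_continuous_comp _ _ _ A c (fun v : 'rV[R]_n => v 0 i)) => // v _.
exact: coord_continuous.
Qed.

(** On each open piece the velocity agrees with a continuous function; what it is at the break
    points does not matter. *)
Lemma measurable_fun_speed c : piecewise_C1 c ->
  measurable_fun `[(0 : R), 1] (speed c).
Proof.
move=> [s ps C1c]; rewrite (_ : speed c = Num.sqrt \o
    (fun t => E (c t) * \sum_i 'D_1 c t 0 i * 'D_1 c t 0 i)); last first.
  by apply/funext => t; rewrite speedE.
have mcc (f : R -> R) a b : {within `[a, b], continuous f} ->
    measurable_fun `]a, b[ f.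
  move=> /subspace_continuous_measurable_fun mf.
  apply: measurable_funS (mf _) => //; exact: subset_itv_oo_cc.
apply: measurableT_comp.
  by apply: continuous_measurable_fun; exact: sqrt_continuous.
apply: measurable_funM.
  apply: measurable_fun_partition ps _ => i /C1c[cc _].
  by apply: mcc; apply: (@within_continuous_comp _ _ _ _ c E) => // x _;
    exact: cE.
apply: measurable_sum => j.
suff mD : measurable_fun `[(0 : R), 1] (fun t => 'D_1 c t 0 j).
  exact: measurable_funM.
apply: measurable_fun_partition ps _ => i /C1c[_ [d cd dc]].
apply: (eq_measurable_fun (fun t => d t 0 j)).
  move=> t; rewrite inE/= in_itv/= => /dc dct.
  by rewrite (@derive_val _ _ _ _ _ _ _ dct).
by apply: mcc; exact: within_continuous_coord.
Qed.

Lemma speed_ge_coord c t i : m * `|'D_1 c t 0 i| <= speed c t.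
Proof.
rewrite speedE -(ger0_norm (ltW m_gt0)) -normrM -sqrtr_sqr ler_wsqrtr//.
rewrite exprMn; apply: ler_pM => //; rewrite ?sqr_ge0//.
rewrite (bigD1 i)//= -expr2 lerDl; apply: sumr_ge0 => j _.
by rewrite -expr2 sqr_ge0.
Qed.

(** Each coordinate of a curve, scaled by [m], changes no faster than the speed, so its total change
    is at most the length. *)
Lemma riemannian_distance_ge p q :
  ((m * `|q - p|)%:E <= riemannian_distance g p q)%E.
Proof.
apply/ereal_infP => _ [c [C1c c0 c1] <-].
rewrite /curve_length -/(speed c).
have [s ps Cs] := C1c.
have coord i : ((m * `|(q - p) 0 i|)%:E <=
    \int[@lebesgue_measure R]_(t in `[0%R, 1%R]) (speed c t)%:E)%E.
  rewrite -(ger0_norm (ltW m_gt0)) -normrM !mxE -c0 -c1 mulrBr.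
  apply: (@le_dist_integral_partition _ _ (fun t => m * c t 0 i) _ _ _ ps).
  - exact: measurable_fun_speed.
  - by move=> t; exact: sqrtr_ge0.
  move=> j js mf; have [cc [d cd dc]] := Cs _ js.
  have lt_s : nth 0 (0 :: s) j < nth 0 s j.
    by case: ps => /(pathP 0) /(_ _ js).
  apply: (@le_dist_integral_derive _ _ (fun t => m * c t 0 i)
    (fun t => m * d t 0 i)) => //.
  - apply: (@within_continuous_comp _ _ _ _ (fun t => c t 0 i) (fun t => m * t)).
      by move=> t _; exact: mulrl_continuous.
    exact: within_continuous_coord.
  - apply: (@within_continuous_comp _ _ _ _ (fun t => d t 0 i) (fun t => m * t)).
      by move=> t _; exact: mulrl_continuous.
    exact: within_continuous_coord.
  - move=> t /dc /(is_derive_coord i) dct.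
    by have := @is_deriveZ R _ _ _ m t 1 _ dct.
  - move=> t /dc dct.
    rewrite normrM (ger0_norm (ltW m_gt0)).
    by have := speed_ge_coord c t i; rewrite (@derive_val _ _ _ _ _ _ _ dct).
(* A nonzero sup norm is attained at some coordinate; norm zero, the only case when [n = 0], is
   treated apart. *)
have [->|nz] := eqVneq `|q - p| 0.
  by rewrite mulr0; apply: integral_ge0 => t _; rewrite lee_fin sqrtr_ge0.
have [[j i] qpi] := mx_norm_neq0 nz.
by rewrite [`|_|]qpi/= ord1; exact: coord.
Qed.

Lemma is_derive_segment p v (t : R) : is_derive t 1 (fun s => p + s *: v) v.
Proof.
have dv : is_derive t 1 (fun s : R => s *: v) v.
  split.
    exact/diff_derivable/differentiableZl.
  rewrite deriveE; last exact: differentiableZl.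
  by rewrite diffZl//= diff_val scale1r.
by have := is_deriveD (is_derive_cst p t 1) dv; rewrite add0r.
Qed.

(** The segment from [p] to [q] is a competitor. Its Euclidean speed squared is at most
    [n |q - p|^2], and the cruder [n^2] keeps the constant free of a square root. *)
Lemma riemannian_distance_le p q :
  (riemannian_distance g p q <= (M * n%:R * `|q - p|)%:E)%E.
Proof.
pose c (t : R) := p + t *: (q - p).
have dc (t : R) : is_derive t 1 c (q - p) by exact: is_derive_segment.
have cc : continuous c.
  move=> t; apply: differentiable_continuous; apply/derivable1_diffP.
  by case: (dc t).
have C1c : piecewise_C1 c.
  exists [:: 1]; first exact: itv_partition1.
  case=> // _; split; first exact: continuous_subspaceT.
  exists (fun=> q - p) => //.
  by apply: continuous_subspaceT => t; exact: cvg_cst.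
apply: (@le_trans _ _ (curve_length g c)).
  apply: ereal_inf_lbound; exists c => //; split=> //.
    by rewrite /c scale0r addr0.
  by rewrite /c scale1r addrC subrK.
rewrite /curve_length.
rewrite -[leRHS]mule1.
(* The constant bound is read as its own integral over the unit interval, to compare integrands. *)
rewrite -[1%E](_ : lebesgue_measure (`[0%R, 1%R] : set R) = 1%E); last first.
  by rewrite lebesgue_measure_itv/= lte01 oppr0 adde0.
rewrite -integral_cst//.
apply: ge0_le_integral => //.
- by apply/measurable_EFinP; exact: (measurable_fun_speed C1c).
move=> t _; rewrite lee_fin -/(speed c t) speedE.
have r0 : 0 <= M * n%:R * `|q - p| by rewrite !mulr_ge0// ltW.
rewrite -(ger0_norm r0) -sqrtr_sqr ler_wsqrtr// -mulrA exprMn.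
apply: ler_pM => //.
- by apply: le_trans (mE _); exact: sqr_ge0.
- by apply: sumr_ge0 => i _; rewrite -expr2 sqr_ge0.
rewrite (@derive_val _ _ _ _ _ _ _ (dc t)).
apply: (@le_trans _ _ (\sum_(i < n) `|q - p| ^+ 2)).
  apply: ler_sum => i _; rewrite -expr2 -real_normK ?num_real//.
  by rewrite lerXn2r ?nnegrE// norm_coord_le.
rewrite sumr_const card_ord -[_ ^+ 2 *+ n]mulr_natl exprMn ler_wpM2r ?sqr_ge0//.
by rewrite -natrX ler_nat; case: (n) => // n'; rewrite expnS leq_pmulr.
Qed.

(** The lower bound makes a Cauchy sequence Cauchy in the sup norm, hence convergent in [R^n]; the
    upper bound turns this into convergence for the Riemannian distance. *)
Lemma complete_metric_conformally_flat : (0 < n)%N -> complete_metric g.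
Proof.
move=> n_gt0 u cauchy_u.
have cu : cvg (u @ \oo).
  apply/cauchy_cvgP/cauchy_exP => e e0.
  have [N uN] := cauchy_u _ (mulr_gt0 m_gt0 e0).
  exists (u N); exists N => // i /= Ni.
  have := le_lt_trans (riemannian_distance_ge (u i) (u N)) (uN _ _ Ni (leqnn N)).
  by rewrite lte_fin ltr_pM2l// mx_norm_ball.
exists (lim (u @ \oo)) => e e0.
have K0 : 0 < M * n%:R by rewrite mulr_gt0// ltr0n.
have /cvgrPdist_lt/(_ _ (divr_gt0 e0 K0))[N _ uN] := cu.
exists N => i /uN /= Ni; apply: le_lt_trans (riemannian_distance_le _ _) _.
by rewrite lte_fin mulrC -ltr_pdivlMr.
Qed.

End ConformallyFlatDistance.

(** * The metric [g / phi^2]: smoothness, curvature and completeness *)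

Theorem corollary3p7 (R : realType) (n : nat) (hn : (3 <= n)%N) (k : 'I_n)
    (C : R) (hC : 0 < C) (h : R -> R) (hsmooth : smooth1 h)
    (H : R -> R) (HH : forall t : R, is_derive t 1 H (h t)) :
  let g : tensor2 R n := @euclidean R n in
  let fk (t : R) := (h t ^+ 2 - 2 * derive1 h t) / (2 * C ^+ 2) * expR (2 * H t) in
  let f (t : R) := - (h t ^+ 2 / (2 * C ^+ 2)) * expR (2 * H t) in
  let T : tensor2 R n := fun x =>
    fk (x 0 k) *: delta_mx k k
    + f (x 0 k) *: \sum_(i < n | i != k) delta_mx i i in
  let phi (x : 'rV[R]_n) := C * expR (- H (x 0 k)) in
  exists gbar : tensor2 R n,
    [/\ riemannian_metric gbar,
        gbar = conformal g phi,
        curvature gbar = kulkarni_nomizu T g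
      & (exists L : R, forall t : R, 0 <= `|H t| <= L) -> complete_metric gbar].
Proof.
move=> g fk f T phi.
(* This is [1 / phi^2] as a function of [x_k]. *)
pose E t := (C ^+ 2)^-1 * expR (2 * H t).
have C0 : C != 0 by exact: lt0r_neq0.
have E_gt0 t : 0 < E t by rewrite mulr_gt0 ?expR_gt0 ?invr_gt0 ?exprn_gt0.
have dE (t : R) : is_derive t 1 E (2 * h t * E t).
  have dH2 : is_derive t 1 (fun s => 2 * H s) (2 * h t).
    by have := @is_deriveZ R _ _ H 2 t 1 _ (HH t).
  have de := @is_derive1_comp _ expR _ _ _ _ (is_derive_expR _) dH2.
  have dZ := @is_deriveZ R _ _ _ (C ^+ 2)^-1 t 1 _ de.
  by apply: (is_derive_eq dZ); rewrite /E /GRing.scale/=; ring.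
have sE : smooth1 E.
  apply: (smooth1_linear_ode _ dE).
  by apply: (@smooth1M _ (cst 2) h) => //; exact: smooth1_cst.
have gE : conformal g phi = fun x => (E (x 0 k))%:M.
  apply/funext => x; rewrite /conformal /g euclideanE scalemx1; congr (_%:M).
  by rewrite /phi exprMn -expRM_natl mulrN expRN invfM invrK.
exists (conformal g phi); split=> //.
- rewrite gE; split=> [i j|x|x X X0].
  + rewrite (_ : (fun x => _) = fun x : 'rV_n => (i == j)%:R * E (x 0 k)).
      apply: (@smooth_coord_comp _ _ (fun t => (i == j)%:R * E t)).
      by apply: (@smooth1M _ (cst (i == j)%:R) E) => //; exact: smooth1_cst.
    by apply/funext => x; rewrite mxE mulr_natl.
  + exact: tr_scalar_mx.
  + rewrite bilin_scalar mulr_gt0//.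
    have [i Xi] : exists i, X 0 i != 0.
      by apply/rV0Pn.
    rewrite (bigD1 i)//= ltr_wpDr//.
      by apply: sumr_ge0 => j _; rewrite -expr2 sqr_ge0.
    by rewrite -expr2 exprn_even_gt0.
- rewrite gE (curvature_conformally_flat k E_gt0 dE (hsmooth 0%N)).
  (* [fk] and [f] are the coefficients [(h^2/2 - h') E] and [-(h^2/2) E] with [E] written out. *)
  congr kulkarni_nomizu; apply/funext => x; rewrite /T /fk /f /E.
  by congr (_ *: _ + _ *: _); field.
- move=> [L HL]; rewrite gE.
  have HN t : - L <= H t <= L by rewrite -ler_norml; case/andP: (HL t).
  (* The square root of [E] is [e^H / C], and [-L <= H <= L] puts it between these two constants. *)
  apply: (@complete_metric_conformally_flat _ _ (fun x => E (x 0 k))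
    (expR (- L) / C) (expR L / C)).
  + move=> x; apply: differentiable_continuous; apply: differentiable_coord_comp.
    exact: (sE 0).
  + by rewrite divr_gt0 ?expR_gt0.
  + by rewrite divr_gt0 ?expR_gt0.
  + move=> x; rewrite expr_div_n -expRM_natl mulrC ler_pM2l ?invr_gt0 ?exprn_gt0//.
    by rewrite ler_expR ler_pM2l//; case/andP: (HN (x 0 k)).
  + move=> x; rewrite expr_div_n -expRM_natl mulrC ler_pM2l ?invr_gt0 ?exprn_gt0//.
    by rewrite ler_expR ler_pM2l//; case/andP: (HN (x 0 k)).
  + exact: leq_trans hn.
Qed.
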